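(* Let $n\ge 2$ be an integer and let $\mathbf{P}\colon[q_1,\infty)\to\Delta_n$ be a quasi-regular $(n,0)$-system with mesh at least $\log 4$. Then there exists a unit vector $\mathbf{u}$ of $\mathbb{R}^n$ such that \[ \|\mathbf{P}(q)-\mathbf{L}_{\mathbf{u}}(q)\|_\infty \le 2n^2 \quad\text{for all } q\ge q_1 . \]
   Context: Throughout $n\ge 2$ is an integer, $\mathbf{x}\cdot\mathbf{y}$ is the usual scalar product on $\mathbb{R}^n$, $\|\mathbf{x}\|=(\mathbf{x}\cdot\mathbf{x})^{1/2}$ is the Euclidean norm, and $\|\ \|_\infty$ is the maximum norm on $\mathbb{R}^n$. Set $\Delta_n=\{(x_1,\dots,x_n)\in\mathbb{R}^n : x_1\le\cdots\le x_n\}$, and let $\Phi_n\colon\mathbb{R}^n\to\Delta_n$ be the map which lists the coordinates of a point in monotone increasing order. Quasi-regular systems: a quasi-regular $(n,0)$-system is a continuous function $\mathbf{P}\colon[a,\infty)\to\Delta_n$ for which there exists an unbounded strictly increasing sequence of positive real numbers $(X_i)_{i\ge1}$ such that, upon defining $q_i=(X_i+\cdots+X_{i+n-1})/n$ for $i\ge1$, we have $a=q_1$ and, for each $i\ge 1$, \[ \mathbf{P}(q)=\Phi_n\big(X_i+n(q-q_i)-q,\;X_{i+1}-q,\;\dots,\;X_{i+n-1}-q\big)\quad(q_i\le q\le q_{i+1}). \] The sequence $(X_i)_{i\ge 1}$ is uniquely determined by $\mathbf{P}$. For $\delta>0$, one says that $\mathbf{P}$ has mesh at least $\delta$ if moreover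 $X_{i+1}\ge X_i+\delta$ for each $i\ge1$. Successive minima: for a unit vector $\mathbf{u}$ of $\mathbb{R}^n$ and a real number $Q\ge1$, let \[ \mathcal{C}_{\mathbf{u}}(Q)=\{\mathbf{x}\in\mathbb{R}^n : \|\mathbf{x}\|\le Q,\ |\mathbf{x}\cdot\mathbf{u}|\le Q^{-(n-1)}\}. \] For $j=1,\dots,n$, $\lambda_j(\mathcal{C}_{\mathbf{u}}(Q))$ denotes the smallest real number $\lambda$ such that $\lambda\,\mathcal{C}_{\mathbf{u}}(Q)$ contains at least $j$ linearly independent elements of $\mathbb{Z}^n$. The map $\mathbf{L}_{\mathbf{u}}\colon[0,\infty)\to\Delta_n$ is defined by \[ \mathbf{L}_{\mathbf{u}}(q)=\big(\log\lambda_1(\mathcal{C}_{\mathbf{u}}(e^q)),\dots,\log\lambda_n(\mathcal{C}_{\mathbf{u}}(e^q))\big)\quad(q\ge0). \] *)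

(* Defs.v *)
From HB Require Import structures.
From mathcomp Require Import all_boot all_order all_algebra.
From mathcomp Require Import all_classical all_reals all_analysis.

Set Implicit Arguments.
Unset Strict Implicit.
Unset Printing Implicit Defensive.

Import Order.TTheory GRing.Theory Num.Theory.
Import numFieldNormedType.Exports.

Local Open Scope classical_set_scope.
Local Open Scope ring_scope.

(* The maximum norm on R^n is the library norm `|x| on 'rV[R]_n. *)

Definition dotp (R : realType) (n : nat) (x y : 'rV[R]_n) : R :=
  \sum_i x 0 i * y 0 i.

Definition enorm (R : realType) (n : nat) (x : 'rV[R]_n) : R :=
  Num.sqrt (dotp x x).

Definition monotone_points (R : realType) (n : nat) : set 'rV[R]_n :=
  [set x | forall i j : 'I_n, (i <= j)%N -> x 0 i <= x 0 j].

Definition sort_coords (R : realType) (n : nat) (x : 'rV[R]_n) : 'rV[R]_n :=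
  \row_(i < n) (sort <=%R [seq x 0 j | j <- enum 'I_n])`_i.

(* Sequences are indexed from 0, so that [X i] stands for X_(i+1) and
   [breakpoint n X i] for q_(i+1) in the customary 1-based notation. *)
Definition breakpoint (R : realType) (n : nat) (X : nat -> R) (i : nat) : R :=
  (\sum_(i <= k < i + n) X k) / n%:R.

(* The point (X_i + n (q - q_i) - q, X_(i+1) - q, ..., X_(i+n-1) - q). *)
Definition moving_point (R : realType) (n : nat) (X : nat -> R) (i : nat)
    (q : R) : 'rV[R]_n :=
  \row_(j < n) (if (j == 0 :> nat)%N
                then X i + n%:R * (q - breakpoint n X i) - q
                else X (i + j)%N - q).

Definition generates (R : realType) (n : nat) (X : nat -> R) (a : R)
    (P : R -> 'rV[R]_n) : Prop :=
  [/\ forall i, 0 < X i,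
      forall i, X i < X i.+1,
      ~ has_ubound (range X),
      a = breakpoint n X 0
    & forall i q, breakpoint n X i <= q <= breakpoint n X i.+1 ->
        P q = sort_coords (moving_point n X i q)].

(* A function on [a, +oo[ is a total function [P] of which only the
   restriction to [a, +oo[ is used. *)
Definition quasi_regular_system (R : realType) (n : nat) (a : R)
    (P : R -> 'rV[R]_n) : Prop :=
  [/\ {within `[a, +oo[, continuous P},
      forall q, a <= q -> monotone_points (P q)
    & exists X, generates X a P].

(* [X] is determined by [P], so the existential names the sequence of [P]. *)
Definition mesh_at_least (R : realType) (n : nat) (delta a : R)
    (P : R -> 'rV[R]_n) : Prop :=
  exists2 X, generates X a P & forall i, X i + delta <= X i.+1.

Definition convex_body (R : realType) (n : nat) (u : 'rV[R]_n) (Q : R) :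
    set 'rV[R]_n :=
  [set x | enorm x <= Q /\ `|dotp x u| <= Q ^- (n - 1)].

Definition integer_points (R : realType) (n : nat) : set 'rV[R]_n :=
  [set x | forall i, x 0 i \is a Num.int].

Definition contains_free_integer_points (R : realType) (n : nat) (j : nat)
    (C : set 'rV[R]_n) : Prop :=
  exists A : 'M[R]_(j, n),
    row_free A /\ forall i, C (row i A) /\ integer_points (row i A).

(* The dilation factors are nonnegative: as the bodies are symmetric about 0,
   negative factors would leave the set below without a least element. *)
Definition dilation_factors (R : realType) (n : nat) (C : set 'rV[R]_n)
    (j : nat) : set R :=
  [set l | 0 <= l /\
           contains_free_integer_points j [set l *: x | x in C]].

(* The least element of [dilation_factors C j]; it exists for 1 <= j <= n and
   [C = convex_body u Q] with 1 <= Q. *)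
Definition successive_minimum (R : realType) (n : nat) (C : set 'rV[R]_n)
    (j : nat) : R :=
  get (dilation_factors C j `&` lbound (dilation_factors C j)).

Definition log_minima (R : realType) (n : nat) (u : 'rV[R]_n) (q : R) :
    'rV[R]_n :=
  \row_(j < n) ln (successive_minimum (convex_body u (expR q)) j.+1).

(* Main.v *)
Require Import Defs.
From HB Require Import structures.
From mathcomp Require Import all_boot all_order all_algebra perm.
From mathcomp Require Import all_classical all_reals all_analysis.
From mathcomp Require Import ring lra zify.

Set Implicit Arguments.
Unset Strict Implicit.
Unset Printing Implicit Defensive.

Import Order.TTheory GRing.Theory Num.Theory.
Import numFieldNormedType.Exports.

Local Open Scope classical_set_scope.
Local Open Scope ring_scope.

(** Write n = d + 1.  The logarithm of the least dilation of the convex body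
    at e^q containing a point z is max (log |z| - q, log |z.u| + d q).  The
    system P is generated by such trajectories: on [q_i, q_(i+1)] its
    coordinates are, up to order, those of points x_i, ..., x_(i+d) with
    |x_m| = exp X_m and |x_m.u| = exp (- X_(m+1) - ... - X_(m+d)); the point
    x_i is the one whose second term dominates, and at q_(i+1) its trajectory
    is taken over by x_(i+d+1).  It suffices to find integer points x_m and a
    unit vector u for which any n consecutive points are independent and both
    equalities hold as upper bounds, up to a factor e^4
    ([moving_point_body]).  Then log lambda_j <= P_j + 4.

    The lower bound on the minima comes for free ([log_minima_near]).  The
    coordinates of P sum to 0.  Suppose that j independent integer points lie
    in a dilate of ratio l.  One of them has a nonzero coordinate on one of
    the n - j + 1 largest of the points x_i, ..., x_(i+d), so replacing that
    point by it leaves n independent integer points, whose determinant is at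
    least 1 in absolute value.  As this determinant is at most a constant
    times the product of the dilation ratios of its rows, l cannot be much
    smaller than e^(P_j) ([basis_bounds_free_points]).

    For the construction ([points_of_fast_growing]) split off the coordinate 0
    and call the other d coordinates the projection.  Put A_m = 10 exp X_m, so
    that A_(m+1) >= 4 A_m.  The points are chosen so that the projection of x_m
    is within A_m / 5, for the sum norm, of A_m times the basis vector of index
    m mod d.  Any d consecutive projections thus form a strictly diagonally
    dominant matrix M, and no error accumulates.  The next point x_(i+d) is
    x_(i-1) plus the integer combination of x_i, ..., x_(i+d-1) obtained by
    rounding the coordinates of the ideal position: the rounding moves the
    projection by at most half the sum of the norms of the d points, that is
    by (1/2) (6/5) (A_i + ... + A_(i+d-1)) <= A_(i+d) / 5.

    The vector u is the direction of the limit of the vectors w_i, with first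
    coordinate 1, orthogonal to x_i, ..., x_(i+d-1).  The offset x_(i-1).w_i
    times the determinant of the projections only changes sign with i
    ([replace_row_det]) and is 1 in absolute value at the start.  Diagonal
    dominance bounds that determinant below, so the offset is at most
    (5/4)^d / (A_i ... A_(i+d-1)).  The same dominance shows that w_i moves by
    at most 5/4 of the offset bound divided by A_(i+d) ([normal_drift]); these
    bounds decrease geometrically, so the limit exists and is close enough to
    w_(i+1) for x_i.u to satisfy the bound on x_i.w_(i+1) up to a factor 2. *)

(** * Determinants and diagonally dominant matrices *)

(** Expanding the product of the row sums gives one term for each map from
    rows to columns; the Leibniz formula only keeps the permutations. *)
Lemma det_le_prod_row_norms (R : realFieldType) (n : nat) (A : 'M[R]_n) :
  `|\det A| <= \prod_i \sum_j `|A i j|.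
Proof.
rewrite bigA_distr_bigA /=.
apply: le_trans (ler_norm_sum _ _ _) _.
have -> : \sum_(s : 'S_n) `|(-1) ^+ s * \prod_i A i (s i)| =
    \sum_(f in imset (fun s : 'S_n => pval s) (mem predT)) \prod_i `|A i (f i)|.
  rewrite big_imset /=; last by move=> s t _ _; exact: val_inj.
  rewrite big_mkcond [RHS]big_mkcond; apply: eq_bigr => s _.
  rewrite normrM normrX normrN1 expr1n mul1r normr_prod.
  by apply: eq_bigr => i _; rewrite ?pvalE.
rewrite [leRHS](bigID (mem (imset (fun s : 'S_n => pval s) (mem predT)))) /=.
by rewrite lerDl sumr_ge0 // => f _; exact: prodr_ge0.
Qed.

(** A quantitative form of diagonal dominance that bounds the whole error row
    in sum norm, so that it passes to integer combinations of rows without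
    losing a factor depending on the dimension. *)
Definition dominated (R : realFieldType) (d : nat) (a : 'I_d -> R)
    (M : 'M[R]_d) : Prop :=
  forall c, \sum_k `|M c k - a c *+ (c == k)| <= a c / 5.

(** Look at the row whose index is that of the largest coordinate of [v]. *)
Lemma dominated_sup_le (R : realFieldType) (d : nat) (a : 'I_d -> R)
    (M : 'M[R]_d) (v : 'cV[R]_d) (r : R) :
  (forall c, 0 < a c) -> dominated a M ->
  (forall c, `|(M *m v) c 0| <= r * (4 / 5 * a c)) -> forall k, `|v k 0| <= r.
Proof.
move=> a_gt0 domM Mv k.
have [m _ vm] := arg_maxP (fun k => `|v k 0|) (erefl : xpredT k).
have {}vm k0 : `|v k0 0| <= `|v m 0| by exact: vm.
apply: le_trans (vm k) _.
rewrite -(ler_pM2r (_ : 0 < 4 / 5 * a m)); last first.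
  by rewrite mulr_gt0 ?divr_gt0.
apply: le_trans (Mv m).
have -> : (M *m v) m 0 =
    a m * v m 0 + \sum_k0 (M m k0 - a m *+ (m == k0)) * v k0 0.
  have -> : a m * v m 0 = \sum_k0 (a m *+ (m == k0)) * v k0 0.
    rewrite (bigD1 m) //= eqxx mulr1n big1 ?addr0 // => k0 /negbTE.
    by rewrite eq_sym => ->; rewrite mulr0n mul0r.
  rewrite -big_split /= mxE; apply: eq_bigr => k0 _.
  by rewrite -mulrDl addrC subrK.
have err : `|\sum_k0 (M m k0 - a m *+ (m == k0)) * v k0 0| <=
    a m / 5 * `|v m 0|.
  apply: le_trans (ler_norm_sum _ _ _) _.
  apply: le_trans (ler_wpM2r (normr_ge0 _) (domM m)).
  rewrite mulr_suml; apply: ler_sum => k0 _.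
  by rewrite normrM ler_wpM2l // vm.
have := lerB_normD (a m * v m 0)
  (\sum_k0 (M m k0 - a m *+ (m == k0)) * v k0 0).
rewrite normrM gtr0_norm //; lra.
Qed.

Lemma unitmx_of_injective (F : fieldType) (n : nat) (M : 'M[F]_n) :
  (forall v : 'cV[F]_n, M *m v = 0 -> v = 0) -> M \in unitmx.
Proof.
move=> injM; rewrite -unitmx_tr -row_free_unit -kermx_eq0.
apply/eqP/row_matrixP => i; rewrite row0; apply: trmx_inj; rewrite trmx0.
apply: injM; have /sub_kermxP : (row i (kermx M^T) <= kermx M^T)%MS.
  exact: row_sub.
by move/(congr1 trmx); rewrite trmx_mul trmxK trmx0.
Qed.

Lemma dominated_unitmx (R : realFieldType) (d : nat) (a : 'I_d -> R)
    (M : 'M[R]_d) :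
  (forall c, 0 < a c) -> dominated a M -> M \in unitmx.
Proof.
move=> a_gt0 domM; apply: unitmx_of_injective => v Mv.
apply/colP => k; rewrite [RHS]mxE; apply/eqP; rewrite -normr_le0.
apply: (dominated_sup_le a_gt0 domM) => c.
by rewrite Mv mxE normr0 mul0r.
Qed.

(** The inverse of [M], with its columns rescaled by [4 / 5 * a], does not
    increase the sup norm; so its rows have sum norm at most 1, and the row-sum
    bound shows that its determinant is at most 1. *)
Lemma dominated_det_ge (R : realFieldType) (d : nat) (a : 'I_d -> R)
    (M : 'M[R]_d) :
  (forall c, 0 < a c) -> dominated a M -> \prod_c (4 / 5 * a c) <= `|\det M|.
Proof.
move=> a_gt0 domM; have uM := dominated_unitmx a_gt0 domM.
pose b c := 4 / 5 * a c.
have b_gt0 c : 0 < b c by rewrite mulr_gt0 ?divr_gt0.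
pose D : 'M[R]_d := diag_mx (\row_c b c).
have detD : \det D = \prod_c b c.
  by rewrite det_diag; apply: eq_bigr => c _; rewrite mxE.
have rows k : \sum_c `|(invmx M *m D) k c| <= 1.
  (* signs chosen so that the product with row [k] is its sum norm *)
  pose v : 'cV[R]_d := \col_c (b c * Num.sg (invmx M k c)).
  have -> : \sum_c `|(invmx M *m D) k c| = (invmx M *m v) k 0.
    rewrite mxE; apply: eq_bigr => c _.
    rewrite mul_mx_diag !mxE normrM (gtr0_norm (b_gt0 c)).
    by rewrite normrEsg [RHS]mulrCA mulrC [in RHS](mulrC (invmx M k c)).
  apply: le_trans (ler_norm _) _.
  apply: (dominated_sup_le a_gt0 domM) => c.
  rewrite mulKVmx // mxE normrM (gtr0_norm (b_gt0 c)) mul1r.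
  by rewrite ler_piMr ?(ltW (b_gt0 c)) // normr_sg lern1 leq_b1.
have : `|\det (invmx M *m D)| <= 1.
  apply: le_trans (det_le_prod_row_norms _) _.
  by apply: prodr_ile1 => k _; rewrite rows sumr_ge0.
have det_gt0 : 0 < `|\det M|.
  by rewrite normr_gt0; move: uM; rewrite unitmxE unitfE.
rewrite det_mulmx det_inv normrM detD normfV.
rewrite ger0_norm; first by rewrite ler_pdivrMl // mulr1.
by apply: prodr_ge0 => c _; rewrite ltW.
Qed.

(** * Determinants of integer points in dilated bodies *)

Lemma det_int (R : archiRealFieldType) (n : nat) (A : 'M[R]_n) :
  (forall i j, A i j \is a Num.int) -> \det A \is a Num.int.
Proof.
move=> Aint; rewrite /determinant rpred_sum // => s _.
by rewrite rpredM ?rpredX ?rpredN ?rpred1 // rpred_prod.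
Qed.

Lemma int_norm_lt1 (R : archiRealFieldType) (x : R) :
  x \is a Num.int -> `|x| < 1 -> x = 0.
Proof.
case/intrP => m ->; rewrite -intr_norm -[1]/(1%:~R) ltr_int => m_lt1.
by have -> : m = 0 by lia.
Qed.

Definition replace_row (R : Type) (m n : nat) (A : 'M[R]_(m, n)) (k : 'I_m)
    (v : 'rV[R]_n) : 'M[R]_(m, n) :=
  \matrix_(i, j) if i == k then v 0 j else A i j.

Lemma det_replace_row (R : comPzRingType) (n : nat) (A : 'M[R]_n) (k : 'I_n)
    (v : 'rV[R]_n) :
  \det (replace_row A k v) = (v *m \adj A) 0 k.
Proof.
rewrite (expand_det_row _ k) mxE; apply: eq_bigr => j _.
rewrite !mxE eqxx; congr (_ * _); rewrite /cofactor; congr (_ * \det _).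
by apply/matrixP => i l; rewrite !mxE eq_sym (negbTE (neq_lift _ _)).
Qed.

(** The column operation replacing column [k] of [Z] by [Z *m u] multiplies
    the determinant by [u k 0], and turns the two bounds defining the convex
    body into bounds on separate columns.  Their powers of [Q] cancel in the
    product, which is why only the dilation ratios [nu] are left. *)
Lemma det_le_mixed (R : realFieldType) (d : nat) (Z : 'M[R]_d.+1)
    (u : 'cV[R]_d.+1) (nu : 'I_d.+1 -> R) (Q : R) (k : 'I_d.+1) :
  0 < Q -> (forall i, 0 <= nu i) -> d.+1%:R^-1 <= `|u k 0| ->
  (forall i j, `|Z i j| <= nu i * Q) ->
  (forall i, `|(Z *m u) i 0| <= nu i * Q ^- d) ->
  `|\det Z| <= d.+1%:R ^+ d.+2 * \prod_i nu i.
Proof.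
move=> Q_gt0 nu_ge0 uk ZQ Zu.
pose T : 'M[R]_d.+1 :=
  \matrix_(i, j) if j == k then Q ^+ d * u i 0 else Q^-1 *+ (i == j).
have ukT : \det T = u k 0.
  rewrite (expand_det_row _ k) (bigD1 k) //= big1 ?addr0; last first.
    by move=> j jk; rewrite mxE (negbTE jk) eq_sym (negbTE jk) mulr0n mul0r.
  rewrite mxE eqxx /cofactor -signr_odd oddD addbb expr0 mul1r.
  have -> : row' k (col' k T) = Q^-1%:M.
    apply/matrixP => i j; rewrite !mxE eq_sym (negbTE (neq_lift _ _)).
    by rewrite (inj_eq lift_inj).
  rewrite det_scalar exprVn mulrAC mulfV ?mul1r //.
  by rewrite expf_neq0 // gt_eqF.
have ZT i j : `|(Z *m T) i j| <= nu i.
  have [->|jk] := eqVneq j k.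
    have -> : (Z *m T) i k = Q ^+ d * (Z *m u) i 0.
      rewrite !mxE mulr_sumr; apply: eq_bigr => l _.
      by rewrite mxE eqxx mulrCA.
    rewrite normrM (gtr0_norm (exprn_gt0 _ Q_gt0)).
    by rewrite mulrC -ler_pdivlMr ?exprn_gt0 // Zu.
  have -> : (Z *m T) i j = Z i j * Q^-1.
    rewrite mxE (bigD1 j) //= mxE (negbTE jk) eqxx mulr1n big1 ?addr0 //.
    by move=> l lj; rewrite mxE (negbTE jk) (negbTE lj) mulr0n mulr0.
  by rewrite normrM (gtr0_norm (_ : 0 < Q^-1)) ?invr_gt0 // ler_pdivrMr ?ZQ.
have := det_le_prod_row_norms (Z *m T).
rewrite det_mulmx ukT normrM => detZ.
have {detZ} : `|\det Z| * d.+1%:R^-1 <= d.+1%:R ^+ d.+1 * \prod_i nu i.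
  apply: le_trans (ler_wpM2l (normr_ge0 _) uk) _.
  apply: le_trans detZ _.
  have -> : d.+1%:R ^+ d.+1 * \prod_i nu i = \prod_i (d.+1%:R * nu i).
    by rewrite big_split /= prodr_const card_ord.
  apply: ler_prod => i _; rewrite sumr_ge0 //=.
  have -> : d.+1%:R * nu i = \sum_(j < d.+1) nu i.
    by rewrite sumr_const card_ord mulr_natl.
  exact: ler_sum.
by rewrite ler_pdivrMr ?ltr0n // mulrAC -exprSr.
Qed.

(** The intervals [[t i - e i, t i + e i]] are nested. *)
Lemma nested_limit (R : realType) (t e : nat -> R) :
  (forall i, 0 <= e i) -> (forall i, `|t i.+1 - t i| <= e i - e i.+1) ->
  exists l, forall i, `|l - t i| <= e i.
Proof.
move=> e_ge0 te.
have lower i j : t i - e i <= t (i + j)%N - e (i + j)%N.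
  elim: j => [|j IH]; first by rewrite addn0.
  rewrite addnS; apply: le_trans IH _.
  have := te (i + j)%N; rewrite ler_norml; lra.
have upper i j : t (i + j)%N + e (i + j)%N <= t i + e i.
  elim: j => [|j IH]; first by rewrite addn0.
  rewrite addnS; apply: le_trans _ IH.
  have := te (i + j)%N; rewrite ler_norml; lra.
have ub i : ubound (range (fun i => t i - e i)) (t i + e i).
  move=> _ [j _ <-].
  have := lower j i; have := upper i j; have := e_ge0 (i + j)%N.
  rewrite addnC; lra.
exists (sup (range (fun i => t i - e i))) => i.
rewrite ler_distl; apply/andP; split.
  apply: ub_le_sup; first by exists (t 0 + e 0); exact: ub.
  by exists i.
apply: sup_le_ub; last exact: ub.
by exists (t 0 - e 0); exists 0.
Qed.

(** * Integer points and dilated convex bodies *)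

Lemma coord_le_enorm (R : realType) (n : nat) (x : 'rV[R]_n) (i : 'I_n) :
  `|x 0 i| <= enorm x.
Proof.
rewrite -sqrtr_sqr ler_wsqrtr // /dotp (bigD1 i) //= -expr2 lerDl.
by rewrite sumr_ge0 // => j _; rewrite -expr2 sqr_ge0.
Qed.

Lemma dotpE (R : realType) (n : nat) (x u : 'rV[R]_n) :
  dotp x u = (x *m u^T) 0 0.
Proof. by rewrite mxE; apply: eq_bigr => i _; rewrite mxE. Qed.

Lemma dotpZl (R : realType) (n : nat) (l : R) (x u : 'rV[R]_n) :
  dotp (l *: x) u = l * dotp x u.
Proof. by rewrite !dotpE -scalemxAl mxE. Qed.

Lemma dotpZr (R : realType) (n : nat) (l : R) (x u : 'rV[R]_n) :
  dotp x (l *: u) = l * dotp x u.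
Proof. by rewrite !dotpE linearZ -scalemxAr mxE. Qed.

Lemma dotp_ge0 (R : realType) (n : nat) (x : 'rV[R]_n) : 0 <= dotp x x.
Proof. by rewrite sumr_ge0 // => i _; rewrite -expr2 sqr_ge0. Qed.

Lemma enormZ (R : realType) (n : nat) (l : R) (x : 'rV[R]_n) :
  enorm (l *: x) = `|l| * enorm x.
Proof.
by rewrite /enorm dotpZl dotpZr mulrA -expr2 sqrtrM ?sqr_ge0 // sqrtr_sqr.
Qed.

Lemma enorm_eq0 (R : realType) (n : nat) (x : 'rV[R]_n) :
  enorm x <= 0 -> x = 0.
Proof.
move=> x0; apply/rowP => i; rewrite mxE; apply/eqP.
by rewrite -normr_le0 (le_trans (coord_le_enorm _ _)).
Qed.

Lemma dilated_bodyP (R : realType) (n : nat) (u z : 'rV[R]_n) (Q l : R) :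
  0 < Q -> 0 <= l ->
  [set l *: x | x in convex_body u Q] z <->
  enorm z <= l * Q /\ `|dotp z u| <= l * Q ^- (n - 1).
Proof.
move=> Q_gt0; rewrite le_eqVlt => /predU1P[<-|l_gt0].
  rewrite !mul0r; split=> [[x _ <-]|[z0 _]].
    by rewrite enormZ dotpZl normrM normr0 !mul0r.
  exists 0; last by rewrite scale0r (enorm_eq0 z0).
  rewrite -(scale0r 0) /convex_body /= enormZ dotpZl normrM normr0 !mul0r.
  by rewrite ltW ?invr_ge0 ?exprn_ge0 ?ltW.
have ln : `|l| = l by rewrite gtr0_norm.
split=> [[x [xQ xu] <-]|[zQ zu]].
  by rewrite enormZ dotpZl normrM ln !ler_pM2l.
exists (l^-1 *: z); last by rewrite scalerA mulfV ?gt_eqF // scale1r.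
by rewrite /convex_body /= enormZ dotpZl normrM normfV ln !ler_pdivrMl.
Qed.

Lemma unit_vector_large_coord (R : realType) (n : nat) (u : 'rV[R]_n) :
  enorm u = 1 -> exists k, n%:R^-1 <= `|u 0 k|.
Proof.
move=> u1; apply/existsP; apply: contraT => /existsPn small.
have n_gt0 : (0 < n)%N.
  case: n u u1 small => // u; rewrite /enorm /dotp big_ord0 sqrtr0.
  by move=> /esym/eqP; rewrite oner_eq0.
have : dotp u u < 1.
  have -> : 1 = \sum_(i < n) n%:R^-1 :> R.
    by rewrite sumr_const card_ord -[RHS]mulr_natl mulfV // pnatr_eq0 -lt0n.
  apply: ltr_sum => [|i _].
    by apply/hasP; exists (Ordinal n_gt0); rewrite ?mem_index_enum.
  rewrite -expr2 -real_normK ?num_real //.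
  have := small i; rewrite -ltNge => ui.
  apply: le_lt_trans ui; rewrite expr2 ler_piMr //.
  by rewrite -u1 coord_le_enorm.
suff -> : dotp u u = 1 by rewrite ltxx.
rewrite -[dotp u u](@sqr_sqrtr R) ?dotp_ge0 // -/(enorm u) u1.
by rewrite expr1n.
Qed.

(** If the conclusion failed, replacing row [k] of [B] by any row of [A] would
    give an integer determinant smaller than 1, hence zero, for every [k >= j].
    By Cramer's rule the rows of [A] would lie in the span of the first [j]
    rows of [B], which is too small. *)
Lemma basis_bounds_free_points (R : realType) (d j : nat) (u : 'rV[R]_d.+1)
    (Q l : R) (B : 'M[R]_d.+1) (mu : 'I_d.+1 -> R) (A : 'M[R]_(j.+1, d.+1)) :
  enorm u = 1 -> 0 < Q -> 0 <= l -> B \in unitmx ->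
  (forall i, integer_points (row i B)) ->
  (forall i, 0 < mu i) ->
  (forall i, [set mu i *: x | x in convex_body u Q] (row i B)) ->
  row_free A ->
  (forall i, integer_points (row i A)) ->
  (forall i, [set l *: x | x in convex_body u Q] (row i A)) ->
  exists2 k : 'I_d.+1, (j <= k)%N &
    mu k <= d.+1%:R ^+ d.+2 * l * \prod_i mu i.
Proof.
move=> u1 Q_gt0 l_ge0 uB Bint mu_gt0 Bmu freeA Aint Al.
suff : [exists k : 'I_d.+1, (j <= k)%N &&
    (mu k <= d.+1%:R ^+ d.+2 * l * \prod_i mu i)].
  by case/existsP => k /andP[? ?]; exists k.
apply: contraT => /existsPn small.
have [k0 uk0] := unit_vector_large_coord u1.
have vanish i (k : 'I_d.+1) : (j <= k)%N -> (A *m \adj B) i k = 0.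
  move=> jk.
  have -> : (A *m \adj B) i k = \det (replace_row B k (row i A)).
    by rewrite det_replace_row -row_mul [RHS]mxE.
  apply: int_norm_lt1.
    apply: det_int => m n; rewrite mxE; case: ifP => _; first exact: Aint.
    by have := Bint m n; rewrite mxE.
  pose nu m := if m == k then l else mu m.
  have nu_ge0 m : 0 <= nu m by rewrite /nu; case: ifP => // _; rewrite ltW.
  have rowZ m : row m (replace_row B k (row i A)) =
      if m == k then row i A else row m B.
    by apply/rowP => n; rewrite !mxE; case: ifP; rewrite ?mxE.
  have bnd m : enorm (row m (replace_row B k (row i A))) <= nu m * Q /\
      `|dotp (row m (replace_row B k (row i A))) u| <= nu m * Q ^- d.
    rewrite rowZ /nu; have := Al i; have := Bmu m; case: ifP => _.
      by move=> _ /dilated_bodyP-/(_ Q_gt0 l_ge0); rewrite subn1.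
    by move=> /dilated_bodyP-/(_ Q_gt0 (ltW (mu_gt0 m))); rewrite subn1.
  have := @det_le_mixed _ _ (replace_row B k (row i A)) u^T nu Q k0 Q_gt0 nu_ge0.
  rewrite mxE => /(_ uk0) detle.
  apply: le_lt_trans (detle _ _) _ => [m n|m|].
  - have := coord_le_enorm (row m (replace_row B k (row i A))) n.
    rewrite [X in `|X|]mxE => /le_trans; apply; exact: (bnd m).1.
  - rewrite -[X in `|X|](_ : dotp (row m (replace_row B k (row i A))) u = _).
      exact: (bnd m).2.
    by rewrite dotpE -row_mul mxE.
  - have := small k; rewrite jk /= -ltNge => muk.
    rewrite -(ltr_pM2l (mu_gt0 k)) mulr1; apply: le_lt_trans muk.
    rewrite (bigD1 k) //= /nu eqxx [in leRHS](bigD1 k) //=.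
    rewrite (eq_bigr mu); last by move=> m /negbTE ->.
    by rewrite le_eqVlt; apply/orP; left; apply/eqP; ring.
have adjB : \adj B \in unitmx.
  have := mul_mx_adj B; move: uB; rewrite unitmxE => uB.
  move=> /(congr1 (mulmx (invmx B))).
  rewrite mulKmx // => ->; rewrite unitmx_mul unitmx_inv !unitmxE.
  by rewrite det_scalar unitrX ?uB.
have rk : \rank (A *m \adj B) = j.+1.
  by rewrite mxrankMfree ?row_free_unit //; exact/eqP.
have : (\rank (A *m \adj B) <= j)%N.
  have -> : A *m \adj B = A *m \adj B *m pid_mx j.
    apply/matrixP => i k; rewrite [RHS]mxE (bigD1 k) //= big1 ?addr0.
      rewrite [pid_mx _ _ _]mxE eqxx /=; case: ltnP => [_|/vanish ->].
        by rewrite mulr1.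
      by rewrite mul0r.
    move=> m mk; rewrite [pid_mx _ _ _]mxE.
    by rewrite (_ : (m == k :> nat) = false) ?mulr0 //; exact: negbTE.
  have <- : (pid_mx j : 'M[R]_(d.+1, j)) *m (pid_mx j : 'M[R]_(j, d.+1)) =
      pid_mx j :> 'M[R]_d.+1 by rewrite pid_mx_id.
  rewrite mulmxA.
  exact: leq_trans (mxrankM_maxl _ _) (rank_leq_col _).
by rewrite rk ltnn.
Qed.

(** * Existence of the successive minima *)

Definition gauge (R : realType) (n : nat) (u : 'rV[R]_n) (Q : R)
    (z : 'rV[R]_n) : R :=
  Num.max (enorm z / Q) (`|dotp z u| * Q ^+ (n - 1)).

Lemma gaugeP (R : realType) (n : nat) (u z : 'rV[R]_n) (Q l : R) :
  0 < Q -> 0 <= l ->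
  [set l *: x | x in convex_body u Q] z <-> gauge u Q z <= l.
Proof.
move=> Q_gt0 l_ge0; rewrite dilated_bodyP // ge_max ler_pdivrMr //.
by rewrite -ler_pdivlMr ?exprn_gt0 //; split=> [[-> ->]|/andP[]].
Qed.

Lemma finite_integer_box (R : realType) (m n : nat) (b : R) :
  exists (T : finType) (f : T -> 'M[R]_(m, n)),
    (forall t i, integer_points (row i (f t))) /\
    forall A, (forall i, integer_points (row i A)) ->
      (forall i k, `|A i k| <= b) -> exists t, f t = A.
Proof.
have [N bN] : exists N : nat, b <= N%:R.
  exists (Num.bound `|b|); apply: le_trans (ler_norm b) _.
  by rewrite ltW // archi_boundP.
pose f (t : 'M['I_(N + N).+1]_(m, n)) : 'M[R]_(m, n) :=
  \matrix_(i, k) ((t i k)%:R - N%:R).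
exists ('M['I_(N + N).+1]_(m, n) : finType), f; split=> [t i k|A Aint Ab].
  by rewrite !mxE rpredB ?intr_nat.
exists (\matrix_(i, k) inord `|(Num.floor (A i k) + N%:Z)%R|%N).
apply/matrixP => i k; rewrite !mxE.
have Aik : A i k \is a Num.int by have := Aint i k; rewrite mxE.
have Aflo : A i k = (Num.floor (A i k))%:~R by rewrite (floorK Aik).
have : `|Num.floor (A i k)| <= N%:Z.
  by rewrite -(ler_int R) intr_norm -Aflo (le_trans (Ab i k)).
rewrite [in RHS]Aflo; move: (Num.floor _) => z zN.
rewrite inordK; last by lia.
have -> : `|(z + N%:Z)%R|%N%:R = (z + N%:Z)%:~R :> R.
  by rewrite [LHS]pmulrn; congr (_%:~R); lia.
by rewrite intrD -pmulrn addrK.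
Qed.

(** Below a given dilation ratio only finitely many integer matrices compete,
    so the infimum over them is a minimum. *)
Lemma successive_minimum_attained (R : realType) (n j : nat) (u : 'rV[R]_n)
    (Q l0 : R) :
  0 < Q -> dilation_factors (convex_body u Q) j l0 ->
  (dilation_factors (convex_body u Q) j `&`
   lbound (dilation_factors (convex_body u Q) j))
    (successive_minimum (convex_body u Q) j).
Proof.
move=> Q_gt0 l0P; apply: getPex.
pose F (A : 'M[R]_(j, n)) := \big[Num.max/0]_i gauge u Q (row i A).
have F_ge0 A : 0 <= F A by exact: bigmax_ge_id.
have DF l : dilation_factors (convex_body u Q) j l <->
    exists A, [/\ row_free A, (forall i, integer_points (row i A)) & F A <= l].
  split=> [[l_ge0 [A [freeA Al]]]|[A [freeA Aint FA]]].
    exists A; split=> // [i|]; first by case: (Al i).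
    by apply: bigmax_le => // i _; apply/(gaugeP _ _ Q_gt0 l_ge0); case: (Al i).
  have l_ge0 := le_trans (F_ge0 A) FA.
  split=> //; exists A; split=> // i; split=> //.
  apply/(gaugeP _ _ Q_gt0 l_ge0); apply: le_trans FA.
  exact: (le_bigmax _ (fun i => gauge u Q (row i A))).
have [T [f [f_int f_surj]]] := @finite_integer_box R j n (l0 * Q).
have lift_box A l : (forall i, integer_points (row i A)) -> F A <= l ->
    l <= l0 -> exists t, f t = A.
  move=> Aint FA ll0; apply: f_surj => // i k.
  have <- : (row i A) 0 k = A i k by rewrite mxE.
  apply: le_trans (coord_le_enorm _ _) _; rewrite -ler_pdivrMr //.
  apply: le_trans (le_trans FA ll0).
  apply: le_trans (le_bigmax _ (fun i => gauge u Q (row i A)) i).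
  by rewrite /gauge le_max lexx.
have [A0 [freeA0 A0int FA0]] := (DF l0).1 l0P.
have [t0 t0A] := lift_box _ _ A0int FA0 (lexx _).
have free0 : row_free (f t0) by rewrite t0A.
have [t freet tmin] := arg_minP (F \o f) (free0 : (fun t => row_free (f t)) t0).
exists (F (f t)); split; first by apply/DF; exists (f t).
move=> l /DF[A [freeA Aint FA]].
have [ll0|l0l] := leP l l0.
  have [t' t'A] := lift_box _ _ Aint FA ll0.
  by apply: le_trans FA; rewrite -t'A; apply: tmin; rewrite /= t'A.
by apply: le_trans (tmin _ free0) _; rewrite /= t0A (le_trans FA0) ?ltW.
Qed.

(** * Estimating the minima from a sorted basis *)

(** One-sided information is enough: since the [y i] sum to 0, the product of
    the bounds for the rows of [B] is [expR (d.+1%:R * c)], and a minimum much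
    smaller than expected would contradict [basis_bounds_free_points]. *)
Lemma log_minima_near (R : realType) (d : nat) (u : 'rV[R]_d.+1) (q c : R)
    (B : 'M[R]_d.+1) (y : 'I_d.+1 -> R) :
  enorm u = 1 -> 0 <= c -> B \in unitmx ->
  (forall i, integer_points (row i B)) ->
  (forall i k : 'I_d.+1, (i <= k)%N -> y i <= y k) -> \sum_i y i = 0 ->
  (forall i, [set expR (y i + c) *: x | x in convex_body u (expR q)]
    (row i B)) ->
  forall j : 'I_d.+1,
    y j - d%:R * c - d.+2%:R * ln d.+1%:R <= log_minima u q 0 j <= y j + c.
Proof.
move=> u1 c_ge0 uB Bint y_mono sumy By j; rewrite mxE.
have Q_gt0 := expR_gt0 q.
have upper : dilation_factors (convex_body u (expR q)) j.+1 (expR (y j + c)).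
  split; first exact: expR_ge0.
  exists (pid_mx j.+1 *m B); split.
    by rewrite -row_leq_rank mxrankMfree ?row_free_unit // rank_pid_mx.
  move=> i; have ij : (i <= j)%N by rewrite -ltnS ltn_ord.
  have -> : row i (pid_mx j.+1 *m B) = row (widen_ord (ltn_ord j) i) B.
    apply/rowP => k; rewrite !mxE (bigD1 (widen_ord (ltn_ord j) i)) //= big1.
      by rewrite mxE eqxx ltn_ord mul1r addr0.
    move=> l li; rewrite mxE (_ : (i == l :> nat) = false) ?mul0r //.
    by apply/negbTE; rewrite eq_sym.
  split; last exact: Bint.
  apply/(gaugeP _ _ Q_gt0 (expR_ge0 _)).
  have /(gaugeP _ _ Q_gt0 (expR_ge0 _)) := By (widen_ord (ltn_ord j) i).
  by move=> /le_trans; apply; rewrite ler_expR lerD2r y_mono.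
have [[]] := successive_minimum_attained Q_gt0 upper.
set l := successive_minimum _ _ => l_ge0 [A [freeA Al]] l_min.
have [k jk muk] := @basis_bounds_free_points _ _ _ u (expR q) l B
  (fun i => expR (y i + c)) A u1 Q_gt0 l_ge0 uB Bint
  (fun i => expR_gt0 _) By freeA (fun i => (Al i).2) (fun i => (Al i).1).
have prod_mu : \prod_i expR (y i + c) = expR (d.+1%:R * c).
  rewrite -expR_sum big_split /= sumy add0r sumr_const card_ord.
  by rewrite mulr_natl.
rewrite {}prod_mu in muk.
have l_gt0 : 0 < l.
  rewrite lt_neqAle l_ge0 andbT; apply: contraTneq muk => <-.
  by rewrite mulr0 mul0r -ltNge expR_gt0.
apply/andP; split; last first.
  by rewrite -[leRHS]expRK ler_ln ?posrE ?expR_gt0 // l_min.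
have := y_mono _ _ jk.
have p_gt0 : 0 < d.+1%:R ^+ d.+2 :> R by rewrite exprn_gt0.
have lnp : ln (d.+1%:R ^+ d.+2) = d.+2%:R * ln d.+1%:R :> R.
  by rewrite lnXn // mulr_natl.
move: (_ ^+ _) p_gt0 lnp muk => p p_gt0 lnp.
rewrite -ler_ln ?posrE ?mulr_gt0 ?expR_gt0 //.
rewrite !lnM ?posrE ?mulr_gt0 ?expR_gt0 // !expRK lnp.
rewrite -[d.+1%:R * c]/((1 + d)%:R * c) natrD.
lra.
Qed.

(** * Windows of points and their normals *)

(** The rows of [W] are [d] points of a space of dimension [1 + d]; this is the
    vector orthogonal to them, normalized to have first coordinate 1. *)
Definition normal (R : realFieldType) (d : nat) (W : 'M[R]_(d, 1 + d)) :
    'cV[R]_(1 + d) :=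
  col_mx 1%:M (- (invmx (rsubmx W) *m lsubmx W)).

Lemma mulmx_normal (R : realFieldType) (d : nat) (W : 'M[R]_(d, 1 + d)) :
  rsubmx W \in unitmx -> W *m normal W = 0.
Proof.
move=> uW; rewrite -{1}(hsubmxK W) mul_row_col mulmx1 mulmxN mulKVmx //.
by rewrite subrr.
Qed.

Lemma mulmx_sub_top (R : realFieldType) (m d : nat) (Y : 'M[R]_(m, 1 + d))
    (v w : 'cV[R]_(1 + d)) :
  usubmx v = usubmx w -> Y *m v - Y *m w = rsubmx Y *m (dsubmx v - dsubmx w).
Proof.
move=> vw; rewrite -(hsubmxK Y) -(vsubmxK v) -(vsubmxK w) vw !mul_row_col.
by rewrite !col_mxKd row_mxKr mulmxBr opprD addrACA subrr add0r.
Qed.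

Lemma usubmx_normal (R : realFieldType) (d : nat) (W : 'M[R]_(d, 1 + d)) :
  usubmx (normal W) = 1%:M.
Proof. by rewrite col_mxKu. Qed.

Lemma normal_unique (R : realFieldType) (d : nat) (W : 'M[R]_(d, 1 + d))
    (v : 'cV[R]_(1 + d)) :
  rsubmx W \in unitmx -> W *m v = 0 -> v = usubmx v 0 0 *: normal W.
Proof.
move=> uW Wv; set v' := _ *: _.
have vv' : usubmx v = usubmx v'.
  by rewrite linearZ /= usubmx_normal scalemx1 -mx11_scalar.
have := mulmx_sub_top W vv'.
rewrite Wv -scalemxAr mulmx_normal // scaler0 subrr.
move=> /(congr1 (mulmx (invmx (rsubmx W)))); rewrite mulmx0 mulKmx // => /esym.
move/eqP; rewrite subr_eq0 => /eqP dv.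
by rewrite -[v]vsubmxK -[v']vsubmxK vv' dv.
Qed.

Lemma replace_row_mul (R : comPzRingType) (m n p : nat) (W : 'M[R]_(m, n))
    (c : 'I_m) (v : 'rV[R]_n) (Y : 'M[R]_(n, p)) :
  replace_row W c v *m Y = replace_row (W *m Y) c (v *m Y).
Proof.
apply/matrixP => i j; rewrite !mxE; case: (eqVneq i c) => [->|ic].
  by apply: eq_bigr => k _; rewrite !mxE eqxx.
by apply: eq_bigr => k _; rewrite !mxE (negbTE ic).
Qed.

Lemma rsubmx_replace_row (R : Type) (m n1 n2 : nat) (W : 'M[R]_(m, n1 + n2))
    (c : 'I_m) (v : 'rV[R]_(n1 + n2)) :
  rsubmx (replace_row W c v) = replace_row (rsubmx W) c (rsubmx v).
Proof. by apply/matrixP => i j; rewrite !mxE. Qed.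

Lemma replace_row_normal (R : realFieldType) (d : nat) (W : 'M[R]_(d, 1 + d))
    (c : 'I_d) (z : 'rV[R]_(1 + d)) (a : 'rV[R]_d) :
  rsubmx W \in unitmx ->
  replace_row W c (z + a *m W) *m normal W =
  (z *m normal W) 0 0 *: delta_mx c 0.
Proof.
move=> uW; rewrite replace_row_mul mulmxDl -mulmxA mulmx_normal // mulmx0 addr0.
apply/matrixP => i j; rewrite !ord1 !mxE andbT.
by case: eqP => _; rewrite ?mulr1 ?mulr0.
Qed.

(** The conservation law of the construction.  Both normals have first
    coordinate 1, and [rsubmx W'] sends their difference to a multiple of the
    basis vector [c]; the adjugate of [rsubmx W'] turns this into a ratio of
    two determinants that differ only in row [c]. *)
Lemma replace_row_det (R : realFieldType) (d : nat) (W : 'M[R]_(d, 1 + d))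
    (c : 'I_d) (z : 'rV[R]_(1 + d)) (a : 'rV[R]_d) :
  let W' := replace_row W c (z + a *m W) in
  rsubmx W \in unitmx -> rsubmx W' \in unitmx ->
  (row c W *m normal W') 0 0 * \det (rsubmx W') =
  - ((z *m normal W) 0 0 * \det (rsubmx W)).
Proof.
move=> W' uW uW'; set delta := (z *m normal W) 0 0.
pose eta := dsubmx (normal W') - dsubmx (normal W).
have M'eta : rsubmx W' *m eta = - (delta *: delta_mx c 0).
  rewrite -mulmx_sub_top ?usubmx_normal // mulmx_normal // sub0r.
  by rewrite replace_row_normal.
have -> : row c W *m normal W' = row c (rsubmx W) *m eta.
  have -> : row c (rsubmx W) = rsubmx (row c W).
    by apply/rowP => k; rewrite !mxE.
  rewrite -mulmx_sub_top ?usubmx_normal // -[X in _ - X]row_mul.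
  by rewrite mulmx_normal // row0 subr0.
have -> : (row c (rsubmx W) *m eta) 0 0 * \det (rsubmx W') =
    (row c (rsubmx W) *m \adj (rsubmx W') *m (rsubmx W' *m eta)) 0 0.
  rewrite -mulmxA (mulmxA (\adj _)) mul_adj_mx mul_scalar_mx -scalemxAr.
  by rewrite [RHS]mxE mulrC.
have -> : \det (rsubmx W) =
    (row c (rsubmx W) *m \adj (rsubmx W')) 0 c.
  rewrite -det_replace_row; congr (\det _); apply/matrixP => i j.
  by rewrite rsubmx_replace_row !mxE; case: eqP => [->|].
rewrite M'eta mulmxN -scalemxAr -colE !mxE.
by [].
Qed.

(** * The sequence of windows *)

Definition nearest_int_row (R : archiRealFieldType) (d : nat) (b : 'rV[R]_d) :
    'rV[R]_d := \row_k (Num.floor (b 0 k + 2^-1))%:~R.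

Lemma nearest_int_row_close (R : archiRealFieldType) (d : nat) (b : 'rV[R]_d)
    (k : 'I_d) : `|nearest_int_row b 0 k - b 0 k| <= 1 / 2.
Proof.
rewrite mxE ler_distl.
have := floor_itv (b 0 k + 2^-1); rewrite intrD => /andP[].
set m := _%:~R; rewrite mulr1z; lra.
Qed.

(** With the exact coordinates instead of the rounded ones, the projection of
    the new point would be [target]. *)
Definition next_point (R : archiRealFieldType) (d : nat)
    (W : 'M[R]_(d, 1 + d)) (z : 'rV[R]_(1 + d)) (target : 'rV[R]_d) :
    'rV[R]_(1 + d) :=
  z + nearest_int_row ((target - rsubmx z) *m invmx (rsubmx W)) *m W.

Lemma dominated_row_norm (R : realFieldType) (d : nat) (a : 'I_d -> R)
    (M : 'M[R]_d) (c : 'I_d) :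
  (forall c, 0 < a c) -> dominated a M -> \sum_k `|M c k| <= 6 / 5 * a c.
Proof.
move=> a_gt0 domM.
have : \sum_k `|M c k| <=
    \sum_k `|M c k - a c *+ (c == k)| + \sum_k a c *+ (c == k).
  rewrite -big_split /=; apply: ler_sum => k _.
  have := ler_normD (M c k - a c *+ (c == k)) (a c *+ (c == k)).
  by rewrite subrK (ger0_norm (mulrn_wge0 _ (ltW (a_gt0 c)))).
have -> : \sum_k a c *+ (c == k) = a c.
  rewrite (bigD1 c) //= eqxx mulr1n big1 ?addr0 // => k /negbTE.
  by rewrite eq_sym => ->.
by move=> /le_trans; apply; have := domM c; lra.
Qed.

Lemma next_point_close (R : archiRealFieldType) (d : nat) (a : 'I_d -> R)
    (W : 'M[R]_(d, 1 + d)) (z : 'rV[R]_(1 + d)) (target : 'rV[R]_d) :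
  (forall c, 0 < a c) -> dominated a (rsubmx W) ->
  \sum_k `|rsubmx (next_point W z target) 0 k - target 0 k| <=
  3 / 5 * \sum_c a c.
Proof.
move=> a_gt0 domW; have uW := dominated_unitmx a_gt0 domW.
pose b := (target - rsubmx z) *m invmx (rsubmx W).
pose f := nearest_int_row b - b.
have diff : rsubmx (next_point W z target) - target = f *m rsubmx W.
  have -> : rsubmx (next_point W z target) =
      rsubmx z + nearest_int_row b *m rsubmx W.
    by rewrite /next_point linearD /= -mulmx_rsub.
  rewrite mulmxBl mulmxKV // opprB [RHS]addrA.
  by congr (_ - _); exact: addrC.
have -> : \sum_k `|rsubmx (next_point W z target) 0 k - target 0 k| =
    \sum_k `|(f *m rsubmx W) 0 k|.
  by apply: eq_bigr => k _; rewrite -diff !mxE.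
apply: le_trans (_ : \sum_c 1 / 2 * \sum_k `|rsubmx W c k| <= _).
  under [leRHS]eq_bigr do rewrite mulr_sumr.
  rewrite exchange_big /=; apply: ler_sum => k _; rewrite mxE.
  apply: le_trans (ler_norm_sum _ _ _) _; apply: ler_sum => c _.
  rewrite normrM ler_wpM2r // [f 0 c]mxE [(- b) 0 c]mxE.
  exact: nearest_int_row_close.
rewrite mulr_sumr; apply: ler_sum => c _.
have := dominated_row_norm c a_gt0 domW; lra.
Qed.

(** A state is a window together with the point that has just left it.  The
    point of number [m] is stored in row [m mod e.+1], so that a step changes
    a single row and the dominant entries stay on the diagonal. *)
Definition step (R : archiRealFieldType) (e : nat) (A : nat -> R) (i : nat)
    (S : 'M[R]_(e.+1, 1 + e.+1) * 'rV[R]_(1 + e.+1)) :=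
  let c : 'I_e.+1 := inZp i in
  (replace_row S.1 c (next_point S.1 S.2 (A (i + e.+1)%N *: delta_mx 0 c)),
   row c S.1).

Fixpoint states (R : archiRealFieldType) (e : nat) (A : nat -> R)
    (S0 : 'M[R]_(e.+1, 1 + e.+1) * 'rV[R]_(1 + e.+1)) (i : nat) :=
  if i is i'.+1 then step A i' (states A S0 i') else S0.

(** The sizes of the points stored in the rows of the window at step [i]. *)
Fixpoint scales (R : realFieldType) (e : nat) (A : nat -> R) (i : nat)
    (c : 'I_e.+1) : R :=
  if i is i'.+1
  then if c == inZp i' then A (i' + e.+1)%N else scales A i' c
  else A c.

Lemma inZp_window_eq (e i m : nat) : (i <= m <= i + e)%N ->
  (inZp m == inZp i :> 'I_e.+1) = (m == i).
Proof.
move=> /andP[im mi]; apply/eqP/eqP => [/(congr1 val)/= /eqP|->//].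
rewrite eqn_mod_dvd // => dv; case: (posnP (m - i)) => [|mi_gt0]; first lia.
by have := dvdn_leq mi_gt0 dv; lia.
Qed.

Lemma inZp_addn (e i : nat) : inZp (i + e.+1) = inZp i :> 'I_e.+1.
Proof. by apply: val_inj; rewrite /= modnDr. Qed.

Lemma window_surj (e : nat) (c : 'I_e.+1) (i : nat) :
  exists2 m, (i <= m <= i + e)%N & inZp m = c.
Proof.
elim: i => [|i [m im mc]].
  by exists c; [rewrite leq0n -ltnS ltn_ord | rewrite valZpK].
have [mi|mi] := eqVneq m i; last by exists m => //; lia.
by exists (i + e.+1)%N; [lia | rewrite inZp_addn -mi].
Qed.

Lemma scalesE (R : realFieldType) (e : nat) (A : nat -> R) (i m : nat) :
  (i <= m <= i + e)%N -> scales A i (inZp m : 'I_e.+1) = A m.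
Proof.
elim: i m => [|i IH] m im /=; first by rewrite modn_small //; lia.
have [->|mi] := eqVneq m (i + e.+1)%N; first by rewrite inZp_addn eqxx.
by rewrite inZp_window_eq ?IH ?ifN //; lia.
Qed.

Lemma states_row (R : archiRealFieldType) (e : nat) (A : nat -> R)
    (S0 : 'M[R]_(e.+1, 1 + e.+1) * 'rV[R]_(1 + e.+1)) (i m : nat) :
  (i <= m <= i + e)%N ->
  row (inZp m : 'I_e.+1) (states A S0 i).1 =
  row (inZp m : 'I_e.+1) (states A S0 m).1.
Proof.
move=> im; have [k ke ->] : exists2 k, (k <= e)%N & m = (i + k)%N.
  by exists (m - i)%N; lia.
elim: k i ke {im} => [|k IH] i ke; first by rewrite addn0.
have -> : (i + k.+1 = i.+1 + k)%N by lia.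
rewrite -IH; last by lia.
apply/rowP => j; rewrite !mxE inZp_window_eq ?ifN //; last by lia.
by apply/eqP; lia.
Qed.

(** * Invariants of the sequence *)

(** Growth by a factor 4 is the mesh condition.  The bound 10 leaves room for
    the integer points that start the sequence: their error is at most 2, which
    has to be at most a fifth of their size. *)
Definition fast_growing (R : realFieldType) (A : nat -> R) : Prop :=
  10 <= A 0 /\ forall m, 4 * A m <= A m.+1.

Lemma fast_growing_ge10 (R : realFieldType) (A : nat -> R) :
  fast_growing A -> forall m, 10 <= A m.
Proof. by case=> A0 A4; elim=> // m IH; have := A4 m; lra. Qed.

Lemma fast_growing_jump (R : realFieldType) (A : nat -> R) :
  fast_growing A -> forall i k, 4 * A i <= A (i + k.+1)%N.
Proof.
move=> fgA i; elim=> [|k IH]; first by rewrite addn1 fgA.2.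
rewrite addnS; have := fgA.2 (i + k.+1)%N; have := fast_growing_ge10 fgA i.
by move: IH; lra.
Qed.

Lemma scales_gt0 (R : realFieldType) (e : nat) (A : nat -> R) :
  fast_growing A -> forall i (c : 'I_e.+1), 0 < scales A i c.
Proof.
move=> fgA i c; have [m im <-] := window_surj c i.
by rewrite scalesE // (lt_le_trans _ (fast_growing_ge10 fgA m)).
Qed.

(** Compare with the geometric series of ratio 1/4. *)
Lemma scales_sum_le (R : realFieldType) (e : nat) (A : nat -> R) :
  fast_growing A ->
  forall i, \sum_(c < e.+1) scales A i c <= A (i + e.+1)%N / 3.
Proof.
move=> fgA; elim=> [|i IH] /=.
  rewrite add0n; elim: (e.+1) => [|k IH].
    by rewrite big_ord0; have := fast_growing_ge10 fgA 0; lra.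
  by rewrite big_ord_recr /=; have := fgA.2 k; lra.
rewrite (bigD1 (inZp i)) //= eqxx.
rewrite (eq_bigr (scales A i)) => [|c /negbTE -> //].
move: IH; rewrite (bigD1 (inZp i)) //=.
have := scales_gt0 fgA i (inZp i : 'I_e.+1).
by have := fgA.2 (i + e.+1)%N; rewrite addSn; lra.
Qed.

Lemma window_prod_recr (R : realFieldType) (A : nat -> R) (i k : nat) :
  (\prod_(i.+1 <= m < i.+1 + k) A m) * A i =
  (\prod_(i <= m < i + k) A m) * A (i + k)%N.
Proof.
rewrite addSn -big_nat_recr /= ?leq_addr //.
by rewrite [RHS]big_nat_recl ?leq_addr // big_add1 mulrC.
Qed.

Lemma scales_prod (R : realFieldType) (e : nat) (A : nat -> R) :
  fast_growing A -> forall i,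
  \prod_(c < e.+1) scales A i c = \prod_(i <= m < i + e.+1) A m.
Proof.
move=> fgA; elim=> [|i IH]; first by rewrite big_mkord.
have Ai : A i != 0 by have := fast_growing_ge10 fgA i; lra.
apply: (mulIf Ai); rewrite window_prod_recr -IH /=.
rewrite (bigD1 (inZp i)) //= eqxx [in RHS](bigD1 (inZp i)) //=.
rewrite (eq_bigr (scales A i)) => [|c /negbTE -> //].
by rewrite scalesE ?leqnn ?leq_addr //; ring.
Qed.

Lemma window_prod_gt0 (R : realFieldType) (A : nat -> R) (i j : nat) :
  fast_growing A -> 0 < \prod_(i <= m < j) A m.
Proof.
move=> fgA; apply: prodr_gt0 => m _.
by apply: lt_le_trans (fast_growing_ge10 fgA m).
Qed.

(** How far the point that has left is from the hyperplane of the window. *)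
Definition offset (R : realFieldType) (d : nat)
    (S : 'M[R]_(d, 1 + d) * 'rV[R]_(1 + d)) : R :=
  (S.2 *m normal S.1) 0 0.

Definition good_state (R : realType) (d : nat) (a : 'I_d -> R)
    (S : 'M[R]_(d, 1 + d) * 'rV[R]_(1 + d)) : Prop :=
  [/\ forall c, integer_points (row c S.1), integer_points S.2,
      dominated a (rsubmx S.1) &
      `|offset S * \det (rsubmx S.1)| = 1].

Lemma next_point_int (R : realType) (d : nat) (a : 'I_d -> R)
    (S : 'M[R]_(d, 1 + d) * 'rV[R]_(1 + d)) (target : 'rV[R]_d) :
  good_state a S -> integer_points (next_point S.1 S.2 target).
Proof.
move=> [Wint zint _ _] k; rewrite mxE rpredD // mxE rpred_sum // => c _.
by rewrite rpredM // ?mxE ?intr_int //; have := Wint c k; rewrite mxE.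
Qed.

(** Rounding contributes at most [3 / 5] of the sum of the scales, and that sum
    is at most a third of the next scale: dominance is reproduced exactly. *)
Lemma states_good (R : realType) (e : nat) (A : nat -> R)
    (S0 : 'M[R]_(e.+1, 1 + e.+1) * 'rV[R]_(1 + e.+1)) :
  fast_growing A -> good_state (scales A 0) S0 ->
  forall i, good_state (scales A i) (states A S0 i).
Proof.
move=> fgA good0; elim=> [//|i IH] /=; have [Wint zint dom det1] := IH.
set S := states A S0 i in IH Wint zint dom det1 *; rewrite /step.
set c0 : 'I_e.+1 := inZp i.
set x := next_point S.1 S.2 _.
have dom' : dominated (scales A i.+1) (rsubmx (replace_row S.1 c0 x)).
  move=> c /=; rewrite -/c0; case: (eqVneq c c0) => [{c}->|cc0].
    have := next_point_close S.2 (A (i + e.+1)%N *: delta_mx 0 c0)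
      (scales_gt0 fgA i) dom.
    rewrite -/x => close.
    apply: le_trans (_ : 3 / 5 * \sum_c scales A i c <= _); last first.
      by have := scales_sum_le e fgA i; lra.
    apply: le_trans close; rewrite le_eqVlt; apply/orP; left; apply/eqP.
    apply: eq_bigr => k _; rewrite !mxE eqxx /= [k == c0]eq_sym.
    by rewrite mulr_natr.
  apply: le_trans (dom c); rewrite le_eqVlt; apply/orP; left; apply/eqP.
  by apply: eq_bigr => k _; rewrite !mxE (negbTE cc0).
split=> //.
- move=> c k; rewrite mxE [replace_row _ _ _ _ _]mxE.
  case: ifP => _; first exact: (next_point_int _ IH).
  by have := Wint c k; rewrite mxE.
- exact: Wint.
rewrite /offset /= replace_row_det.
- by rewrite normrN.
- exact: dominated_unitmx (scales_gt0 fgA i) dom.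
- exact: dominated_unitmx (scales_gt0 fgA i.+1) dom'.
Qed.

(** * The initial window *)

(** The matrix of the window is bidiagonal, with 1 in position [(c, c)] and
    about [A c] in position [(c, c.+1)].  Adding the last basis vector as the
    point that has left makes a unimodular matrix, while the projections of the
    rows have their large entries on the diagonal. *)
Definition initial_state (R : realType) (e : nat) (A : nat -> R) :
    'M[R]_(e.+1, 1 + e.+1) * 'rV[R]_(1 + e.+1) :=
  (\matrix_(c, k) ((k == c :> nat)%:R +
                   (Num.floor (A c))%:~R *+ (k == c.+1 :> nat)),
   delta_mx 0 ord_max).

Lemma sum_mulrn_eq (R : nmodType) (n m : nat) (f : nat -> R) :
  \sum_(k < n) f k *+ (k == m :> nat) = f m *+ (m < n)%N.
Proof.
case: ltnP => [mn|nm]; last first.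
  by apply: big1 => k _; rewrite ltn_eqF // (leq_trans (ltn_ord k)).
rewrite (bigD1 (Ordinal mn)) //= eqxx big1 ?addr0 // => k.
by rewrite -val_eqE /= => /negbTE ->.
Qed.

Lemma initial_good (R : realType) (e : nat) (A : nat -> R) :
  fast_growing A -> good_state (scales A 0) (initial_state e A).
Proof.
move=> fgA; pose B m : R := (Num.floor (A m))%:~R.
have A_ge m := fast_growing_ge10 fgA m.
have B_itv m : A m - 1 < B m <= A m.
  by have := floor_itv (A m); rewrite intrD -/(B m) => /andP[]; lra.
have B_neq0 m : B m != 0 by have := B_itv m; have := A_ge m; lra.
set W := (initial_state e A).1.
have WE c (k : 'I_e.+1) : rsubmx W c k =
    (k.+1 == c :> nat)%:R + B c *+ (c == k).
  by rewrite !mxE /= !add1n eqSS [k == c :> nat]eq_sym.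
have dom : dominated (scales A 0) (rsubmx W).
  move=> c /=.
  apply: le_trans (_ : \sum_(k < e.+1) ((k.+1 == c :> nat)%:R +
      `|B c - A c| *+ (k == c :> nat)) <= _).
    apply: ler_sum => k _; rewrite WE -addrA -mulrnBl.
    apply: le_trans (ler_normD _ _) _.
    by rewrite normr_nat normrMn [k == c :> nat]eq_sym.
  rewrite big_split /= (sum_mulrn_eq _ _ (fun=> `|B c - A c|)) ltn_ord mulr1n.
  have : \sum_(k < e.+1) (k.+1 == c :> nat)%:R <= 1 :> R.
    case: (val c) => [|m]; first by rewrite big1.
    under eq_bigr do rewrite eqSS.
    rewrite (sum_mulrn_eq _ _ (fun=> 1)); by case: ltnP => _; rewrite ?ler01.
  have : `|B c - A c| <= 1 by have := B_itv c; rewrite ler_norml; lra.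
  by have := A_ge c; lra.
(* the normal, by back substitution along the two nonzero diagonals *)
pose fix t m : R := if m is m'.+1 then - t m' / B m' else 1.
pose tcol : 'cV[R]_(1 + e.+1) := \col_k t k.
have Wt : W *m tcol = 0.
  apply/matrixP => c j; rewrite !mxE.
  under eq_bigr => k _.
    rewrite !mxE mulrDl mulrnAl mulrnAl -/(B c) mul1r; over.
  rewrite big_split /= (sum_mulrn_eq _ _ t).
  rewrite (sum_mulrn_eq _ _ (fun k => B c * t k)).
  have c1 : (c.+1 < 1 + e.+1)%N by rewrite add1n ltnS ltn_ord.
  rewrite c1 (ltnW c1).
  by rewrite !mulr1n mulrCA mulfV // mulr1 subrr.
have t_prod m : t m * \prod_(c < m) B c = (-1) ^+ m.
  elim: m => [|m IH] /=; first by rewrite big_ord0 mulr1.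
  rewrite big_ord_recr /= exprS -IH mulN1r.
  by move: (B m) (B_neq0 m) => b b_neq0; field.
split=> //.
- by move=> c k; rewrite !mxE rpredD ?rpredMn ?intr_int ?intr_nat.
- by move=> k; rewrite !mxE intr_nat.
have detW : \det (rsubmx W) = \prod_(c < e.+1) B c.
  rewrite det_trig.
    by apply: eq_bigr => c _; rewrite WE eqxx gtn_eqF // add0r.
  apply/is_trig_mxP => c k ck; rewrite WE gtn_eqF ?ltnS 1?ltnW //.
  by rewrite -val_eqE ltn_eqF // addr0.
have uW := dominated_unitmx (scales_gt0 fgA 0) dom.
have -> : offset (initial_state e A) = ((initial_state e A).2 *m tcol) 0 0.
  have t0 : usubmx tcol 0 0 = 1 by rewrite !mxE.
  by rewrite (normal_unique uW Wt) t0 scale1r.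
have -> : ((initial_state e A).2 *m tcol) 0 0 = t e.+1 by rewrite -rowE !mxE.
by rewrite detW t_prod normrX normrN1 expr1n.
Qed.

(** * Convergence of the normals *)

Definition offset_bound (R : realFieldType) (d : nat) (A : nat -> R)
    (i : nat) : R := (5 / 4) ^+ d / \prod_(i <= m < i + d) A m.

Lemma offset_bound_gt0 (R : realFieldType) (d : nat) (A : nat -> R) (i : nat) :
  fast_growing A -> 0 < offset_bound d A i.
Proof.
by move=> fgA; rewrite divr_gt0 ?exprn_gt0 ?divr_gt0 // window_prod_gt0.
Qed.

Lemma offset_bound_decay (R : realFieldType) (e : nat) (A : nat -> R)
    (i : nat) :
  fast_growing A -> 4 * offset_bound e.+1 A i.+1 <= offset_bound e.+1 A i.
Proof.
move=> fgA; rewrite /offset_bound mulrCA ler_pM2l ?exprn_gt0 ?divr_gt0 //.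
have P1 := window_prod_gt0 i.+1 (i.+1 + e.+1)%N fgA.
have P0 := window_prod_gt0 i (i + e.+1)%N fgA.
rewrite ler_pdivrMr // ler_pdivlMl //.
have Ai : 0 < A i by apply: lt_le_trans (fast_growing_ge10 fgA i).
rewrite -(ler_pM2r Ai) window_prod_recr -mulrA ler_pM2l //.
exact: fast_growing_jump.
Qed.

Lemma offset_bound_le1 (R : realFieldType) (e : nat) (A : nat -> R) (i : nat) :
  fast_growing A -> offset_bound e.+1 A i <= 1.
Proof.
move=> fgA; elim: i => [|i IH]; last first.
  have := offset_bound_decay e i fgA.
  by have := offset_bound_gt0 e.+1 i.+1 fgA; lra.
rewrite ler_pdivrMr ?window_prod_gt0 // mul1r big_mkord.
rewrite -[in leLHS](card_ord e.+1) -prodr_const; apply: ler_prod => m _.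
by have := fast_growing_ge10 fgA m; lra.
Qed.

Lemma good_state_offset_le (R : realType) (e : nat) (A : nat -> R) (i : nat)
    (S : 'M[R]_(e.+1, 1 + e.+1) * 'rV[R]_(1 + e.+1)) :
  fast_growing A -> good_state (scales A i) S ->
  `|offset S| <= offset_bound e.+1 A i.
Proof.
move=> fgA [_ _ dom]; rewrite normrM => det1.
have P_gt0 := window_prod_gt0 i (i + e.+1)%N fgA.
have := dominated_det_ge (scales_gt0 fgA i) dom.
rewrite big_split /= prodr_const card_ord scales_prod // => det_ge.
rewrite ler_pdivlMr //.
have -> : (5 / 4) ^+ e.+1 = (5 / 4) ^+ e.+1 *
    (`|offset S| * `|\det (rsubmx S.1)|) by rewrite det1 mulr1.
rewrite mulrCA ler_wpM2l //.
rewrite -ler_pdivrMl ?exprn_gt0 ?divr_gt0 // -exprVn.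
by have -> : (5 / 4)^-1 = 4 / 5 :> R by field.
Qed.

(** The new window annihilates the old normal except in the row of the new
    point, where the value is the offset. *)
Lemma normal_drift (R : realType) (e : nat) (A : nat -> R) (i : nat)
    (S : 'M[R]_(e.+1, 1 + e.+1) * 'rV[R]_(1 + e.+1)) (k : 'I_e.+1) :
  fast_growing A -> good_state (scales A i) S ->
  good_state (scales A i.+1) (step A i S) ->
  `|dsubmx (normal (step A i S).1) k 0 - dsubmx (normal S.1) k 0| <=
  5 / 4 * offset_bound e.+1 A i / A (i + e.+1)%N.
Proof.
move=> fgA goodS [_ _ dom' _]; have [_ _ dom _] := goodS.
have s_gt0 (c : 'I_e.+1) := scales_gt0 fgA i c.
have s'_gt0 (c : 'I_e.+1) := scales_gt0 fgA i.+1 c.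
have uW := dominated_unitmx s_gt0 dom.
have uW' := dominated_unitmx s'_gt0 dom'.
have offS := good_state_offset_le fgA goodS.
have A_gt0 : 0 < A (i + e.+1)%N.
  by apply: lt_le_trans (fast_growing_ge10 fgA _).
have -> : dsubmx (normal (step A i S).1) k 0 - dsubmx (normal S.1) k 0 =
  (dsubmx (normal (step A i S).1) - dsubmx (normal S.1)) k 0 by rewrite !mxE.
apply: (dominated_sup_le s'_gt0 dom') => c.
rewrite -mulmx_sub_top ?usubmx_normal // mulmx_normal // sub0r.
rewrite /step /= /next_point replace_row_normal // -/(offset S).
rewrite mxE normrN mxE normrM mxE eqxx andbT.
case: eqP => _; last first.
  rewrite normr0 mulr0; apply: mulr_ge0.
    apply: divr_ge0 (ltW A_gt0).
    apply: mulr_ge0; first by rewrite divr_ge0.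
    exact/ltW/offset_bound_gt0.
  by apply: mulr_ge0; [rewrite divr_ge0 | exact: ltW (s_gt0 c)].
rewrite normr1 mulr1; apply: le_trans offS _.
by rewrite le_eqVlt; apply/orP; left; apply/eqP; field; rewrite gt_eqF.
Qed.

(** * The limit normal and the sizes of the points *)

Lemma enorm_le_sum (R : realType) (n : nat) (x : 'rV[R]_n) :
  enorm x <= \sum_i `|x 0 i|.
Proof.
have s_ge0 : 0 <= \sum_i `|x 0 i| by rewrite sumr_ge0.
rewrite -[leRHS]ger0_norm // -sqrtr_sqr ler_wsqrtr // expr2 mulr_suml.
apply: ler_sum => i _; rewrite -expr2 -real_normK ?num_real // expr2.
by rewrite ler_wpM2l // (bigD1 i) //= lerDl sumr_ge0.
Qed.

Lemma norm_mulmx_le (R : realFieldType) (d : nat) (p : 'rV[R]_d)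
    (v : 'cV[R]_d) (r : R) :
  (forall k, `|v k 0| <= r) -> `|(p *m v) 0 0| <= (\sum_k `|p 0 k|) * r.
Proof.
move=> vr; rewrite mxE mulr_suml; apply: le_trans (ler_norm_sum _ _ _) _.
by apply: ler_sum => k _; rewrite normrM ler_wpM2l.
Qed.

(** The points are those that successively leave the windows, and [w] is the
    limit of the normals.  The entry 0 of a point is controlled through [w]: its
    product with [w] is small, and the other entries of [w] are at most
    [1 / 4]. *)
Lemma points_of_fast_growing (R : realType) (e : nat) (A : nat -> R) :
  fast_growing A ->
  exists (x : nat -> 'rV[R]_e.+2) (w : 'rV[R]_e.+2),
  [/\ forall m, integer_points (x m), w 0 ord0 = 1,
      forall i, (\matrix_(j < e.+2) x (i + j)%N) \in unitmx,
      forall m, enorm (x m) <= 8 / 5 * A m &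
      forall i, `|dotp (x i) w| <= 2 * offset_bound e.+1 A i.+1].
Proof.
move=> fgA; set S := states A (initial_state e A).
have good : forall i, good_state (scales A i) (S i).
  exact: states_good (initial_good e fgA).
have A_ge m := fast_growing_ge10 fgA m.
have A_gt0 m : 0 < A m by apply: lt_le_trans (A_ge m).
have s_gt0 i (c : 'I_e.+1) := scales_gt0 fgA i c.
have dom i : dominated (scales A i) (rsubmx (S i).1) by case: (good i).
have uS i : rsubmx (S i).1 \in unitmx by exact: dominated_unitmx (s_gt0 i) _.
pose D i := offset_bound e.+1 A i.
have D_gt0 i : 0 < D i by exact: offset_bound_gt0.
have D4 i : 4 * D i.+1 <= D i by exact: offset_bound_decay.
have D1 i : D i <= 1 by exact: offset_bound_le1.
pose x m : 'rV[R]_(1 + e.+1) := row (inZp m) (S m).1.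
have xE m : x m = (S m.+1).2 by [].
(* The drift is at most [5 / 4 * D i / A (i + e.+1)] and decays by a factor
   16, so that its tail is at most [16 / 15] times its first term. *)
pose eb i := 4 / 3 * D i / A (i + e.+1)%N.
have eb_ge0 i : 0 <= eb i.
  by apply: divr_ge0 (ltW (A_gt0 _)); have := D_gt0 i; lra.
have eb16 i : 16 * eb i.+1 <= eb i.
  rewrite /eb addSn ler_pdivlMr // mulrA -mulrAC ler_pdivrMr //.
  have := fgA.2 (i + e.+1)%N; have := D4 i; have := D_gt0 i.+1.
  have := A_gt0 (i + e.+1)%N.
  move: (D _) (D _) (A _) (A _) => a b c f; nra.
have drift i k : `|dsubmx (normal (S i.+1).1) k 0 -
    dsubmx (normal (S i).1) k 0| <= eb i - eb i.+1.
  have := normal_drift k fgA (good i) (good i.+1).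
  rewrite -/(D i) -[step A i (S i)]/(S i.+1).
  have -> : 5 / 4 * D i / A (i + e.+1)%N = 15 / 16 * eb i.
    by rewrite /eb; field; rewrite gt_eqF.
  by have := eb16 i; lra.
have [theta thetaP] := choice (fun k => @nested_limit R
  (fun i => dsubmx (normal (S i).1) k 0) eb eb_ge0 (drift ^~ k)).
pose w : 'cV[R]_(1 + e.+1) := col_mx 1%:M (\col_k theta k).
have w1 : usubmx w = 1%:M by rewrite col_mxKu.
have x_l1 m : \sum_k `|rsubmx (x m) 0 k| <= 6 / 5 * A m.
  have := dominated_row_norm (inZp m) (s_gt0 m) (dom m).
  rewrite scalesE ?leqnn ?leq_addr //; apply: le_trans.
  rewrite le_eqVlt; apply/orP; left; apply/eqP.
  by apply: eq_bigr => k _; rewrite !mxE.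
have xw i : `|(x i *m w) 0 0| <= 2 * D i.+1.
  have -> : (x i *m w) 0 0 = offset (S i.+1) +
      (rsubmx (x i) *m (dsubmx w - dsubmx (normal (S i.+1).1))) 0 0.
    rewrite -mulmx_sub_top ?usubmx_normal // /offset -xE.
    move: (x i *m w) (_ *m normal _) => a b.
    by rewrite [(a - b) 0 0]mxE [(- b) 0 0]mxE; ring.
  apply: le_trans (ler_normD _ _) _.
  have := good_state_offset_le fgA (good i.+1); rewrite -/(D i.+1).
  have : `|(rsubmx (x i) *m (dsubmx w - dsubmx (normal (S i.+1).1))) 0 0| <=
      (\sum_k `|rsubmx (x i) 0 k|) * eb i.+1.
    apply: norm_mulmx_le => k; move: (thetaP k i.+1).
    rewrite [dsubmx w]col_mxKd.
    by move: (dsubmx (normal _)) => v; rewrite !mxE.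
  have : (\sum_k `|rsubmx (x i) 0 k|) * eb i.+1 <= 6 / 5 * A i * eb i.+1.
    by rewrite ler_wpM2r.
  have : A i * eb i.+1 <= 4 / 3 * D i.+1 / 16.
    rewrite /eb mulrA ler_pdivrMr //.
    have A16 : 16 * A i <= A (i.+1 + e.+1)%N.
      have := fast_growing_jump fgA i e; have := fgA.2 (i + e.+1)%N.
      by rewrite addSn; lra.
    by have := ler_wpM2r (ltW (D_gt0 i.+1)) A16; lra.
  have := D_gt0 i.+1; lra.
have theta_le k : `|theta k| <= 1 / 4.
  have := thetaP k 0.
  have : eb 0 <= 1 / 8.
    rewrite ler_pdivrMr //; have := D1 0; have := A_ge e; have := fgA.2 e.
    by rewrite add0n; lra.
  have : `|dsubmx (normal (S 0).1) k 0| <= 1 / 8.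
    apply: (dominated_sup_le (s_gt0 0) (dom 0)) => c.
    rewrite col_mxKd mulmxN mulKVmx // !mxE normrN /= mulr0n addr0 normr_nat.
    have := A_ge c; have : (0 == c :> nat)%:R <= 1 :> R by rewrite lern1 leq_b1.
    lra.
  have := ler_normD (theta k - dsubmx (normal (S 0).1) k 0)
    (dsubmx (normal (S 0).1) k 0).
  by rewrite subrK; lra.
exists x, w^T; split=> [m|||m|i].
- by have [Wint _ _ _] := good m; exact: Wint.
- have -> : w^T 0 ord0 = usubmx w 0 0.
    by rewrite [LHS]mxE [RHS]mxE; congr (w _ _); exact: val_inj.
  by rewrite w1 mxE.
- move=> i; apply: unitmx_of_injective => v Xv.
  have xv j : (j <= e.+1)%N -> x (i + j)%N *m v = 0.
    move=> je; have := congr1 (row (Ordinal (je : (j < e.+2)%N))) Xv.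
    by rewrite row_mul rowK row0.
  (* [v] is a multiple of the normal, and the offset does not vanish *)
  have Wv : (S i.+1).1 *m v = 0.
    apply/row_matrixP => c; rewrite row0 row_mul.
    have [m im <-] := window_surj c i.+1; rewrite states_row //.
    have -> : m = (i + (m - i))%N by lia.
    by apply: xv; lia.
  have vE := normal_unique (uS i.+1) Wv.
  have := xv 0 isT; rewrite addn0 xE vE -scalemxAr => /matrixP/(_ 0 0).
  rewrite [LHS]mxE [RHS]mxE -/(offset _) => /eqP.
  rewrite mulf_eq0 => /orP[/eqP v0|/eqP off0]; first by rewrite v0 scale0r.
  have [_ _ _] := good i.+1.
  by rewrite off0 mul0r normr0 => /esym/eqP; rewrite oner_eq0.
- apply: le_trans (enorm_le_sum _) _.
  rewrite (@big_split_ord _ _ _ 1 e.+1) /= big_ord1.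
  have l1 : \sum_(k < e.+1) `|x m 0 (rshift 1 k)| <= 6 / 5 * A m.
    apply: le_trans (x_l1 m); rewrite le_eqVlt; apply/orP; left; apply/eqP.
    by apply: eq_bigr => k _; rewrite [rsubmx _ _ _]mxE.
  set p := rsubmx (x m) *m \col_k theta k.
  have p_le : `|p 0 0| <= 6 / 5 * A m * (1 / 4).
    apply: le_trans (norm_mulmx_le (r := 1 / 4) _ _) _ => [k|].
      by rewrite mxE theta_le.
    by rewrite ler_wpM2r ?divr_ge0.
  have x0 : x m 0 (lshift e.+1 ord0) = (x m *m w) 0 0 - p 0 0.
    have -> : x m *m w = lsubmx (x m) + p.
      by rewrite -{1}(hsubmxK (x m)) mul_row_col mulmx1.
    by move: p {p_le} => p; rewrite !mxE addrK.
  have := ler_normB ((x m *m w) 0 0) (p 0 0); rewrite -x0.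
  have := xw m; have := D4 m; have := D1 m; have := A_ge m.
  by move: l1 p_le; lra.
- by rewrite dotpE trmxK; exact: xw.
Qed.

(** * The coordinates of the quasi-regular system *)

Lemma sort_coords_perm (R : realType) (n : nat) (x : 'rV[R]_n) :
  exists s : 'S_n, forall i, sort_coords x 0 i = x 0 (s i).
Proof.
pose t := [tuple x 0 j | j < n].
have /tuple_permP[s sE] : perm_eq (sort <=%R t) t by rewrite perm_sort.
exists s => i; rewrite mxE.
have -> : [seq x 0 j | j <- enum 'I_n] = t by rewrite -val_ord_tuple.
by rewrite sE -tnth_nth !tnth_mktuple.
Qed.

Lemma big_window (R : nmodType) (F : nat -> R) (i n : nat) :
  \sum_(i <= k < i + n) F k = \sum_(j < n) F (i + j)%N.
Proof.
rewrite -{1}[i]add0n big_addn addKn big_mkord.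
by apply: eq_bigr => j _; rewrite addnC.
Qed.

Lemma mulr_breakpoint (R : realType) (n : nat) (X : nat -> R) (i : nat) :
  (0 < n)%N -> n%:R * breakpoint n X i = \sum_(i <= k < i + n) X k.
Proof. by move=> n_gt0; rewrite mulrC divfK // pnatr_eq0 -lt0n. Qed.

Lemma breakpoint_le (R : realType) (n : nat) (X : nat -> R) (i k : nat) :
  (forall m, X m < X m.+1) -> breakpoint n X i <= breakpoint n X (i + k).
Proof.
move=> Xinc; elim: k => [|k IH]; first by rewrite addn0.
apply: le_trans IH _; rewrite addnS /breakpoint ler_wpM2r ?invr_ge0 //.
rewrite addSn big_add1 /=; apply: ler_sum => m _; exact: ltW.
Qed.

Lemma le_breakpoint (R : realType) (n : nat) (X : nat -> R) (i : nat) :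
  (0 < n)%N -> (forall m, X m < X m.+1) -> X i <= breakpoint n X i.
Proof.
move=> n_gt0 Xinc; rewrite ler_pdivlMr ?ltr0n //.
have -> : X i * n%:R = \sum_(i <= k < i + n) X i.
  by rewrite sumr_const_nat addKn mulr_natr.
have Xmono : {homo X : k m / (k <= m)%N >-> k <= m}.
  by apply: homo_leq => // [k m p|k]; [exact: le_trans | exact: ltW].
rewrite !big_seq; apply: ler_sum => k; rewrite mem_index_iota => /andP[ik _].
exact: Xmono.
Qed.

Lemma breakpoint_locate (R : realType) (n : nat) (X : nat -> R) (q : R) :
  (0 < n)%N -> (forall m, X m < X m.+1) -> ~ has_ubound (range X) ->
  breakpoint n X 0 <= q ->
  exists i, breakpoint n X i <= q <= breakpoint n X i.+1.
Proof.
move=> n_gt0 Xinc unbounded q0.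
have [m qm] : exists m, q < breakpoint n X m.
  apply: contrapT => no; apply: unbounded; exists q => _ [m _ <-].
  apply: le_trans (le_breakpoint m n_gt0 Xinc) _.
  by rewrite leNgt; apply/negP => qm; apply: no; exists m.
elim: m qm => [|m IH] qm; first by have := lt_le_trans qm q0; rewrite ltxx.
have [mq|/IH//] := leP (breakpoint n X m) q.
by exists m; rewrite mq ltW.
Qed.

Lemma mulr_breakpointS (R : realType) (d : nat) (X : nat -> R) (i : nat) :
  d.+1%:R * breakpoint d.+1 X i = X i + \sum_(i.+1 <= k < i.+1 + d) X k.
Proof. by rewrite mulr_breakpoint // addSnnS big_ltn // -addSnnS leq_addr. Qed.

Lemma moving_pointE (R : realType) (d : nat) (X : nat -> R) (i : nat) (q : R)
    (j : 'I_d.+1) :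
  moving_point d.+1 X i q 0 j = X (i + j)%N - q +
    (d.+1%:R * (q - breakpoint d.+1 X i)) *+ (j == 0 :> nat).
Proof.
rewrite mxE; case: (val j) => [|k]; last by rewrite /= addr0.
by rewrite /= addn0 mulr1n addrAC.
Qed.

(** The breakpoints are normalized for this sum to vanish. *)
Lemma sum_moving_point (R : realType) (d : nat) (X : nat -> R) (i : nat)
    (q : R) : \sum_j moving_point d.+1 X i q 0 j = 0.
Proof.
under eq_bigr do rewrite moving_pointE.
rewrite big_split sumrB /= sumr_const card_ord -big_window.
rewrite (sum_mulrn_eq _ _ (fun=> d.+1%:R * (q - breakpoint d.+1 X i))) mulr1n.
by rewrite -mulr_breakpoint // -[q *+ _]mulr_natl; ring.
Qed.

(** A point is in the dilated body as soon as the moving point dominates the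
    two terms of its trajectory.  For the moving coordinate [j = 0] the second
    term is equal to it, and the first is smaller because [q] is after the
    breakpoint [i]; for the others the first term is equal, and the second is
    smaller because [q] is before the breakpoint [i + j]. *)
Lemma moving_point_body (R : realType) (d : nat) (X : nat -> R) (i : nat)
    (q c : R) (u z : 'rV[R]_d.+1) (j : 'I_d.+1) :
  (forall m, X m < X m.+1) ->
  breakpoint d.+1 X i <= q <= breakpoint d.+1 X i.+1 -> 0 <= c ->
  enorm z <= expR (X (i + j)%N + c) ->
  `|dotp z u| <= expR (- \sum_((i + j).+1 <= k < (i + j).+1 + d) X k) ->
  [set expR (moving_point d.+1 X i q 0 j + c) *: x
    | x in convex_body u (expR q)] z.
Proof.
move=> Xinc /andP[iq qi] c_ge0 z_le zu_le.
apply/(dilated_bodyP _ _ (expR_gt0 q) (expR_ge0 _)); rewrite subn1 /=.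
have n_gt0 : 0 < d.+1%:R :> R by rewrite ltr0n.
split.
  apply: le_trans z_le _; rewrite -expRD ler_expR moving_pointE.
  have : 0 <= (d.+1%:R * (q - breakpoint d.+1 X i)) *+ (j == 0 :> nat).
    by rewrite mulrn_wge0 // mulr_ge0 // subr_ge0.
  lra.
apply: le_trans zu_le _.
rewrite -expRM_natl -expRN -expRD ler_expR moving_pointE.
have := mulr_breakpointS d X (i + j).
set s := \sum_(_ <= _ < _) _ => sE.
have nd : d.+1%:R = d%:R + 1 :> R by rewrite -natr1.
case: (posnP j) => [j0|j_gt0].
  rewrite mulr1n j0 addn0; rewrite j0 addn0 in sE.
  by move: sE; rewrite mulrBr nd; lra.
rewrite addr0.
have : d.+1%:R * q <= d.+1%:R * breakpoint d.+1 X (i + j).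
  rewrite ler_pM2l //; apply: le_trans qi _.
  have -> : (i + j = i.+1 + j.-1)%N by lia.
  exact: breakpoint_le.
by rewrite sE nd; lra.
Qed.

Lemma fast_growing_exp (R : realType) (X : nat -> R) :
  0 < X 0 -> (forall m, X m + ln 4 <= X m.+1) ->
  fast_growing (fun m => 10 * expR (X m)).
Proof.
move=> X0 mesh; split=> [|m].
  by rewrite ler_peMr // -expR0 ler_expR ltW.
by rewrite mulrCA ler_pM2l // -[4]lnK ?posrE // -expRD ler_expR addrC.
Qed.

(** With [A m = 10 * expR (X m)] the constant is [(1 / 8) ^+ e.+1], which
    absorbs the factor 2. *)
Lemma offset_bound_exp (R : realType) (e : nat) (X : nat -> R) (i : nat) :
  2 * offset_bound e.+1 (fun m => 10 * expR (X m)) i <=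
  expR (- \sum_(i <= k < i + e.+1) X k).
Proof.
rewrite /offset_bound big_split /= -expR_sum expRN invfM !mulrA.
rewrite ler_piMl ?invr_ge0 ?expR_ge0 //.
have -> : \prod_(i <= m < i + e.+1) 10 = 10 ^+ e.+1 :> R.
  by rewrite prodr_const_nat addKn.
rewrite -mulrA -expr_div_n exprS.
have : (5 / 4 / 10 : R) ^+ e <= 1 by rewrite exprn_ile1 //; lra.
by move: (_ ^+ e) => y; lra.
Qed.

Lemma expR4_ge16 (R : realType) : 16 <= expR 4 :> R.
Proof.
rewrite -[4]mulr1 expRM_natl (_ : 16 = 2 ^+ 4); last by rewrite -natrX.
by rewrite lerXn2r ?nnegrE ?expR_ge0 // (le_trans _ (expR_ge1Dx 1)) // lexx.
Qed.

Theorem theorem1p2 (R : realType) (n : nat) (hn : (2 <= n)%N)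
    (q1 : R) (P : R -> 'rV[R]_n)
    (hP : quasi_regular_system q1 P)
    (hmesh : mesh_at_least (ln 4) q1 P) :
  exists u : 'rV[R]_n, enorm u = 1 /\
    forall q : R, q1 <= q -> `|P q - log_minima u q| <= 2 * n%:R ^+ 2.
Proof.
case: n hn P hP hmesh => [|[|e]] // _ P [_ P_mono _].
case=> X [X_gt0 Xinc X_unb q1E PE] mesh.
have fgA := fast_growing_exp (X_gt0 0) mesh.
have [x [w [x_int w1 x_free x_norm xw]]] := points_of_fast_growing e fgA.
have w_ge1 : 1 <= enorm w by have := coord_le_enorm w ord0; rewrite w1 normr1.
have w_gt0 : 0 < enorm w by apply: lt_le_trans w_ge1.
pose u := (enorm w)^-1 *: w.
have u1 : enorm u = 1 by rewrite enormZ gtr0_norm ?invr_gt0 // mulVf ?gt_eqF.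
exists u; split=> // q q1q.
have [i /andP[iq qi]] : exists i,
    breakpoint e.+2 X i <= q <= breakpoint e.+2 X i.+1.
  by apply: breakpoint_locate => //; rewrite -q1E.
have [s sE] := sort_coords_perm (moving_point e.+2 X i q).
have PqE j : P q 0 j = moving_point e.+2 X i q 0 (s j).
  by rewrite (PE i) ?iq // sE.
pose B : 'M[R]_e.+2 := row_perm s (\matrix_(j < e.+2) x (i + j)%N).
have rowB j : row j B = x (i + s j)%N.
  by apply/rowP => k; rewrite !mxE.
have uB : B \in unitmx by rewrite /B row_permE unitmx_mul unitmx_perm x_free.
have sum0 : \sum_j P q 0 j = 0.
  rewrite -[RHS](sum_moving_point e.+1 X i q).
  rewrite [RHS](reindex_inj (@perm_inj _ s)).
  by apply: eq_bigr => j _; rewrite PqE.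
have body j : [set expR (P q 0 j + 4) *: z | z in convex_body u (expR q)]
    (row j B).
  rewrite rowB PqE; apply: moving_point_body => //; first by rewrite iq.
    (* [8 / 5 * 10 = 16 <= expR 4] *)
    apply: le_trans (x_norm _) _; rewrite expRD.
    by have := ler_wpM2l (expR_ge0 (X (i + s j)%N)) (expR4_ge16 R); lra.
  apply: le_trans (offset_bound_exp e X _); apply: le_trans (xw _).
  rewrite dotpZr normrM gtr0_norm ?invr_gt0 // ler_piMl // invf_le1 //.
have near (j : 'I_e.+2) : `|P q 0 j - log_minima u q 0 j| <= 2 * e.+2%:R ^+ 2.
  have /andP[] := @log_minima_near R e.+1 u q 4 B (fun j => P q 0 j) u1
    (ler0n _ 4) uB (fun k => eq_ind_r _ (x_int _) (rowB k)) (P_mono q q1q)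
    sum0 body j.
  have ln_le : ln e.+2%:R <= e.+1%:R :> R.
    by rewrite -[e.+2]addn1 natrD addrC le_ln1Dx // (lt_le_trans (ltrN10 _)).
  have e_ge0 : 0 <= e%:R :> R by [].
  have -> : e.+3%:R = e%:R + 3 :> R by rewrite -[e.+3]addn3 natrD.
  have -> : e.+2%:R ^+ 2 = (e%:R + 2) ^+ 2 :> R by rewrite -[e.+2]addn2 natrD.
  have e1 : e.+1%:R = e%:R + 1 :> R by rewrite -natr1.
  move: ln_le; rewrite e1.
  move: (ln _) (log_minima _ _ _ _) (P q 0 j) => a b p ale pb bp.
  (* with [d = e + 1] and [a <= d], what remains is the inequality
     [4 * d + (d + 2) * d <= 2 * (d + 1) ^ 2] *)
  rewrite ler_norml; apply/andP; split; last first.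
    have e3 : 0 <= e%:R + 3 :> R by rewrite addr_ge0.
    have := ler_wpM2l e3 ale; have := sqr_ge0 (e%:R : R); nra.
  have := mulr_ge0 e_ge0 e_ge0; nra.
rewrite /Num.Def.normr /= mx_normrE; apply: bigmax_le => [|[k j] _ /=].
  by rewrite mulr_ge0.
by have := near j; rewrite (ord1 k) !mxE.
Qed.
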